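(* Let $X$ be a Banach space. Every operator $T\in L(X)$ is quasi-conjugate to $B_T$ on $\ell^1(X,\mathbb{Z})$.
   Context: $L(X)$ denotes the bounded linear operators on $X$. $\ell^1(X,\mathbb{Z})$ is the Banach space of families $(x_k)_{k\in\mathbb{Z}}$ in $X$ with $\sum_k\|x_k\|<\infty$ (with the $\ell^1$-norm). $B_T$ is the bounded operator $B_T(x_k)_{k\in\mathbb{Z}}=(Tx_{k+1})_{k\in\mathbb{Z}}$. An operator $T$ on $X$ is quasi-conjugate to an operator $S$ on $Y$ if there exists a continuous map $\phi:Y\to X$ with dense range such that $\phi\circ S=T\circ\phi$. *)

(* Defs.v *)
From Stdlib Require Import Reals Lra Lia ZArith.
From Stdlib Require Import FunctionalExtensionality PropExtensionality.
From Stdlib Require Import ProofIrrelevance ClassicalEpsilon.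
From Coquelicot Require Import Coquelicot.

Open Scope R_scope.

(* Only used for families of nonnegative reals, for which the sum over Z does
   not depend on the way in which Z is exhausted. *)
Definition ex_seriesZ (f : Z -> R) : Prop :=
  ex_series (fun n : nat => f (Z.of_nat n)) /\
  ex_series (fun n : nat => f (- Z.of_nat (S n))%Z).

Definition SeriesZ (f : Z -> R) : R :=
  Series (fun n : nat => f (Z.of_nat n)) +
  Series (fun n : nat => f (- Z.of_nat (S n))%Z).

Lemma ex_series_nonneg_le (f g : nat -> R) :
  (forall n, 0 <= f n <= g n) -> ex_series g -> ex_series f.
Proof.
intros H Hg; apply (ex_series_le f g); [|exact Hg].
intros n; change (norm (f n)) with (Rabs (f n)).
rewrite Rabs_pos_eq; apply H.
Qed.

Lemma ex_series_nonneg_bound (f : nat -> R) (M : R) :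
  (forall n, 0 <= f n) -> (forall n, sum_n f n <= M) -> ex_series f.
Proof.
intros H0 HM.
destruct (ex_finite_lim_seq_incr (sum_n f) M) as [l Hl].
- intros n; rewrite sum_Sn; unfold plus; simpl; specialize (H0 (S n)); lra.
- exact HM.
- exists l; exact Hl.
Qed.

Lemma ex_seriesZ_ext (f g : Z -> R) :
  (forall k, f k = g k) -> ex_seriesZ f -> ex_seriesZ g.
Proof.
intros H [H1 H2]; split.
- exact (ex_series_ext _ _ (fun n => H _) H1).
- exact (ex_series_ext _ _ (fun n => H _) H2).
Qed.

Lemma ex_seriesZ_le (f g : Z -> R) :
  (forall k, 0 <= f k <= g k) -> ex_seriesZ g -> ex_seriesZ f.
Proof.
intros H [H1 H2]; split.
- exact (ex_series_nonneg_le _ _ (fun n => H _) H1).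
- exact (ex_series_nonneg_le _ _ (fun n => H _) H2).
Qed.

Lemma SeriesZ_le (f g : Z -> R) :
  (forall k, 0 <= f k <= g k) -> ex_seriesZ g -> SeriesZ f <= SeriesZ g.
Proof.
intros H [H1 H2]; apply Rplus_le_compat; apply Series_le; try assumption;
  intros n; apply H.
Qed.

Lemma SeriesZ_ext (f g : Z -> R) :
  (forall k, f k = g k) -> SeriesZ f = SeriesZ g.
Proof.
intros H; unfold SeriesZ; f_equal; apply Series_ext; intros n; apply H.
Qed.

Lemma ex_seriesZ_plus (f g : Z -> R) :
  ex_seriesZ f -> ex_seriesZ g -> ex_seriesZ (fun k => f k + g k).
Proof.
intros [H1 H2] [H3 H4]; split.
- exact (ex_series_plus _ _ H1 H3).
- exact (ex_series_plus _ _ H2 H4).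
Qed.

Lemma SeriesZ_plus (f g : Z -> R) :
  ex_seriesZ f -> ex_seriesZ g ->
  SeriesZ (fun k => f k + g k) = SeriesZ f + SeriesZ g.
Proof.
intros [H1 H2] [H3 H4]; unfold SeriesZ.
rewrite (Series_plus _ _ H1 H3), (Series_plus _ _ H2 H4); ring.
Qed.

Lemma ex_seriesZ_scal (c : R) (f : Z -> R) :
  ex_seriesZ f -> ex_seriesZ (fun k => c * f k).
Proof.
intros [H1 H2]; split.
- exact (ex_series_scal_l c _ H1).
- exact (ex_series_scal_l c _ H2).
Qed.

Lemma SeriesZ_scal (c : R) (f : Z -> R) :
  SeriesZ (fun k => c * f k) = c * SeriesZ f.
Proof. unfold SeriesZ; rewrite !Series_scal_l; ring. Qed.

Lemma ex_seriesZ_zero : ex_seriesZ (fun _ => 0).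
Proof.
split; (apply (ex_series_nonneg_bound _ 0); [intros; lra|]);
  intros n; induction n as [|n IH]; try (rewrite sum_O; lra);
  rewrite sum_Sn; unfold plus; simpl; lra.
Qed.

Lemma ex_seriesZ_shift (f : Z -> R) :
  ex_seriesZ f -> ex_seriesZ (fun k => f (k + 1)%Z).
Proof.
intros [H1 H2]; split.
- apply (ex_series_ext (fun n => f (Z.of_nat (S n)))).
  + intros n; f_equal; lia.
  + apply (ex_series_incr_1 (fun n => f (Z.of_nat n))); exact H1.
- apply ex_series_incr_1.
  apply (ex_series_ext (fun n => f (- Z.of_nat (S n))%Z)); [|exact H2].
  intros n; f_equal; lia.
Qed.

Lemma SeriesZ_shift (f : Z -> R) :
  ex_seriesZ f -> SeriesZ (fun k => f (k + 1)%Z) = SeriesZ f.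
Proof.
intros H; pose proof (ex_seriesZ_shift f H) as [_ H'].
destruct H as [H1 H2]; unfold SeriesZ.
rewrite (Series_incr_1 _ H1), (Series_incr_1 _ H').
rewrite (Series_ext (fun n => f (Z.of_nat n + 1)%Z)
                    (fun n => f (Z.of_nat (S n)))) by (intros n; f_equal; lia).
rewrite (Series_ext (fun n => f (- Z.of_nat (S (S n)) + 1)%Z)
                    (fun n => f (- Z.of_nat (S n))%Z))
  by (intros n; f_equal; lia).
simpl; ring.
Qed.

Lemma sum_n_le_Series (f : nat -> R) :
  (forall n, 0 <= f n) -> ex_series f -> forall n, sum_n f n <= Series f.
Proof.
intros H0 H; apply (is_lim_seq_incr_compare (sum_n f)).
- exact (Series_correct f H).
- intros n; rewrite sum_Sn; unfold plus; simpl; specialize (H0 (S n)); lra.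
Qed.

Lemma SeriesZ_ge0 (f : Z -> R) :
  (forall k, 0 <= f k) -> ex_seriesZ f -> 0 <= SeriesZ f.
Proof.
intros H0 H; rewrite <- (Rmult_0_l (SeriesZ f)).
rewrite <- SeriesZ_scal; apply SeriesZ_le; [|exact H].
intros k; specialize (H0 k); lra.
Qed.

Definition partialZ (f : Z -> R) (N : nat) : R :=
  sum_n (fun n : nat => f (Z.of_nat n)) N +
  sum_n (fun n : nat => f (- Z.of_nat (S n))%Z) N.

Lemma partialZ_le_SeriesZ (f : Z -> R) :
  (forall k, 0 <= f k) -> ex_seriesZ f -> forall N, partialZ f N <= SeriesZ f.
Proof.
intros H0 [H1 H2] N; apply Rplus_le_compat; apply sum_n_le_Series;
  try assumption; intros n; apply H0.
Qed.

Lemma term_le_SeriesZ (f : Z -> R) :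
  (forall k, 0 <= f k) -> ex_seriesZ f -> forall k, f k <= SeriesZ f.
Proof.
intros H0 H k.
assert (Hs : forall (g : nat -> R), (forall n, 0 <= g n) ->
               forall n, 0 <= sum_n g n /\ g n <= sum_n g n).
{ intros g Hg n; induction n as [|n [I1 I2]].
  - rewrite sum_O; split; [apply Hg|lra].
  - rewrite sum_Sn; unfold plus; simpl; pose proof (Hg (S n)); lra. }
destruct (Z_le_gt_dec 0 k) as [Hk|Hk].
- pose proof (partialZ_le_SeriesZ f H0 H (Z.to_nat k)) as Hp; unfold partialZ in Hp.
  destruct (Hs (fun n => f (Z.of_nat n)) (fun n => H0 _) (Z.to_nat k)) as [_ A].
  destruct (Hs (fun n => f (- Z.of_nat (S n))%Z) (fun n => H0 _) (Z.to_nat k))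
    as [B _].
  simpl in A; rewrite Z2Nat.id in A by lia; lra.
- pose proof (partialZ_le_SeriesZ f H0 H (Z.to_nat (- k - 1))) as Hp;
    unfold partialZ in Hp.
  destruct (Hs (fun n => f (Z.of_nat n)) (fun n => H0 _) (Z.to_nat (- k - 1)))
    as [A _].
  destruct (Hs (fun n => f (- Z.of_nat (S n))%Z) (fun n => H0 _)
              (Z.to_nat (- k - 1))) as [_ B].
  cbv beta in B.
  replace (- Z.of_nat (S (Z.to_nat (- k - 1))))%Z with k in B by lia; lra.
Qed.

Lemma SeriesZ_bound (f : Z -> R) (M : R) :
  (forall k, 0 <= f k) -> (forall N, partialZ f N <= M) ->
  ex_seriesZ f /\ SeriesZ f <= M.
Proof.
intros H0 HM.
assert (Hs : forall (g : nat -> R), (forall n, 0 <= g n) ->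
               forall n, 0 <= sum_n g n).
{ intros g Hg n; induction n as [|n IH].
  - rewrite sum_O; apply Hg.
  - rewrite sum_Sn; unfold plus; simpl; pose proof (Hg (S n)); lra. }
assert (H1 : ex_series (fun n : nat => f (Z.of_nat n))).
{ apply (ex_series_nonneg_bound _ M); [intros n; apply H0|]; intros n.
  pose proof (HM n) as A; unfold partialZ in A.
  pose proof (Hs (fun n => f (- Z.of_nat (S n))%Z) (fun n => H0 _) n); lra. }
assert (H2 : ex_series (fun n : nat => f (- Z.of_nat (S n))%Z)).
{ apply (ex_series_nonneg_bound _ M); [intros n; apply H0|]; intros n.
  pose proof (HM n) as A; unfold partialZ in A.
  pose proof (Hs (fun n => f (Z.of_nat n)) (fun n => H0 _) n); lra. }
split; [split; assumption|].
apply (is_lim_seq_le (partialZ f) (fun _ => M) (SeriesZ f) M HM).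
- apply is_lim_seq_plus'; [exact (Series_correct _ H1)|exact (Series_correct _ H2)].
- apply is_lim_seq_const.
Qed.

Lemma norm_minus_triangle {K : AbsRing} {V : NormedModule K} (x y z : V) :
  norm (minus x z) <= norm (minus x y) + norm (minus y z).
Proof. rewrite (minus_trans y x z); apply @norm_triangle. Qed.

Lemma norm_le_minus {K : AbsRing} {V : NormedModule K} (x y : V) :
  norm x <= norm (minus x y) + norm y.
Proof.
replace x with (plus (minus x y) y) at 1; [apply @norm_triangle|].
unfold minus; rewrite <- plus_assoc, plus_opp_l; apply @plus_zero_r.
Qed.

Section L1Z.

Context {K : AbsRing} {X : NormedModule K}.

Record l1Z : Type := mk_l1Z {
  l1Z_fam :> Z -> X;
  l1Z_summable : ex_seriesZ (fun k => norm (l1Z_fam k))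
}.

Lemma l1Z_ext (x y : l1Z) : (forall k, x k = y k) -> x = y.
Proof.
destruct x as [x Hx], y as [y Hy]; simpl; intros H.
apply functional_extensionality in H; subst y; f_equal; apply proof_irrelevance.
Qed.

Lemma l1Z_plus_summable (x y : l1Z) :
  ex_seriesZ (fun k => norm (plus (x k) (y k))).
Proof.
apply (ex_seriesZ_le _ (fun k => norm (x k) + norm (y k))).
- intros k; split; [apply norm_ge_0|apply norm_triangle].
- apply ex_seriesZ_plus; apply l1Z_summable.
Qed.

Lemma l1Z_opp_summable (x : l1Z) : ex_seriesZ (fun k => norm (opp (x k))).
Proof.
apply (ex_seriesZ_ext (fun k => norm (x k))); [|apply l1Z_summable].
intros k; now rewrite norm_opp.
Qed.

Lemma l1Z_zero_summable : ex_seriesZ (fun _ : Z => norm (zero : X)).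
Proof.
apply (ex_seriesZ_ext (fun _ => 0)); [|apply ex_seriesZ_zero].
intros _; now rewrite norm_zero.
Qed.

Lemma l1Z_scal_summable (c : K) (x : l1Z) :
  ex_seriesZ (fun k => norm (scal c (x k))).
Proof.
apply (ex_seriesZ_le _ (fun k => abs c * norm (x k))).
- intros k; split; [apply norm_ge_0|apply @norm_scal].
- apply ex_seriesZ_scal, l1Z_summable.
Qed.

Definition l1Z_plus (x y : l1Z) : l1Z :=
  mk_l1Z (fun k => plus (x k) (y k)) (l1Z_plus_summable x y).
Definition l1Z_opp (x : l1Z) : l1Z :=
  mk_l1Z (fun k => opp (x k)) (l1Z_opp_summable x).
Definition l1Z_zero : l1Z := mk_l1Z (fun _ => zero) l1Z_zero_summable.
Definition l1Z_scal (c : K) (x : l1Z) : l1Z :=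
  mk_l1Z (fun k => scal c (x k)) (l1Z_scal_summable c x).
Definition l1Z_norm (x : l1Z) : R := SeriesZ (fun k => norm (x k)).

Lemma l1Z_plus_comm (x y : l1Z) : l1Z_plus x y = l1Z_plus y x.
Proof. apply l1Z_ext; intros k; exact (plus_comm (x k) (y k)). Qed.
Lemma l1Z_plus_assoc (x y z : l1Z) :
  l1Z_plus x (l1Z_plus y z) = l1Z_plus (l1Z_plus x y) z.
Proof. apply l1Z_ext; intros k; apply plus_assoc. Qed.
Lemma l1Z_plus_zero_r (x : l1Z) : l1Z_plus x l1Z_zero = x.
Proof. apply l1Z_ext; intros k; apply plus_zero_r. Qed.

Definition l1Z_AbelianMonoid_mixin : AbelianMonoid.mixin_of l1Z :=
  AbelianMonoid.Mixin l1Z l1Z_plus l1Z_zero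
    l1Z_plus_comm l1Z_plus_assoc l1Z_plus_zero_r.
Canonical l1Z_AbelianMonoid : AbelianMonoid :=
  AbelianMonoid.Pack l1Z l1Z_AbelianMonoid_mixin l1Z.

Lemma l1Z_plus_opp_r (x : l1Z) : plus x (l1Z_opp x) = zero.
Proof. apply l1Z_ext; intros k; exact (plus_opp_r (x k)). Qed.

Definition l1Z_AbelianGroup_mixin : AbelianGroup.mixin_of l1Z_AbelianMonoid :=
  AbelianGroup.Mixin l1Z_AbelianMonoid l1Z_opp l1Z_plus_opp_r.
Canonical l1Z_AbelianGroup : AbelianGroup :=
  AbelianGroup.Pack l1Z
    (AbelianGroup.Class l1Z l1Z_AbelianMonoid_mixin l1Z_AbelianGroup_mixin) l1Z.

Lemma l1Z_scal_assoc (a b : K) (x : l1Z) :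
  l1Z_scal a (l1Z_scal b x) = l1Z_scal (mult a b) x.
Proof. apply l1Z_ext; intros k; apply @scal_assoc. Qed.
Lemma l1Z_scal_one (x : l1Z) : l1Z_scal one x = x.
Proof. apply l1Z_ext; intros k; apply @scal_one. Qed.
Lemma l1Z_scal_distr_l (a : K) (x y : l1Z) :
  l1Z_scal a (plus x y) = plus (l1Z_scal a x) (l1Z_scal a y).
Proof. apply l1Z_ext; intros k; apply @scal_distr_l. Qed.
Lemma l1Z_scal_distr_r (a b : K) (x : l1Z) :
  l1Z_scal (plus a b) x = plus (l1Z_scal a x) (l1Z_scal b x).
Proof. apply l1Z_ext; intros k; apply @scal_distr_r. Qed.

Definition l1Z_ModuleSpace_mixin : ModuleSpace.mixin_of K l1Z_AbelianGroup :=
  ModuleSpace.Mixin K l1Z_AbelianGroup l1Z_scal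
    l1Z_scal_assoc l1Z_scal_one l1Z_scal_distr_l l1Z_scal_distr_r.
Definition l1Z_ModuleSpace_class : ModuleSpace.class_of K l1Z :=
  ModuleSpace.Class K l1Z (AbelianGroup.class l1Z_AbelianGroup)
    l1Z_ModuleSpace_mixin.
Canonical l1Z_ModuleSpace : ModuleSpace K :=
  ModuleSpace.Pack K l1Z l1Z_ModuleSpace_class l1Z.

Lemma l1Z_norm_triangle (x y : l1Z) :
  l1Z_norm (plus x y) <= l1Z_norm x + l1Z_norm y.
Proof.
unfold l1Z_norm; rewrite <- SeriesZ_plus by apply l1Z_summable.
apply SeriesZ_le.
- intros k; split; [apply norm_ge_0|apply @norm_triangle].
- apply ex_seriesZ_plus; apply l1Z_summable.
Qed.

Lemma l1Z_norm_scal (c : K) (x : l1Z) :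
  l1Z_norm (scal c x) <= abs c * l1Z_norm x.
Proof.
unfold l1Z_norm; rewrite <- SeriesZ_scal; apply SeriesZ_le.
- intros k; split; [apply norm_ge_0|apply @norm_scal].
- apply ex_seriesZ_scal, l1Z_summable.
Qed.

Lemma l1Z_coord_le_norm (x : l1Z) (k : Z) : norm (x k) <= l1Z_norm x.
Proof.
apply (term_le_SeriesZ (fun k => norm (x k))); [intros j; apply norm_ge_0|].
apply l1Z_summable.
Qed.

Lemma l1Z_norm_eq_zero (x : l1Z) : l1Z_norm x = 0 -> x = zero.
Proof.
intros H; apply l1Z_ext; intros k; apply @norm_eq_zero.
apply Rle_antisym; [rewrite <- H; apply l1Z_coord_le_norm|apply norm_ge_0].
Qed.

Lemma l1Z_norm_opp (x : l1Z) : l1Z_norm (opp x) = l1Z_norm x.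
Proof. apply SeriesZ_ext; intros k; apply @norm_opp. Qed.

Lemma l1Z_norm_zero : l1Z_norm zero = 0.
Proof.
unfold l1Z_norm.
rewrite (SeriesZ_ext _ (fun k => 0 * 0))
  by (intros k; rewrite Rmult_0_l; apply @norm_zero).
rewrite SeriesZ_scal; ring.
Qed.

Definition l1Z_ball (x : l1Z) (e : R) (y : l1Z) : Prop :=
  l1Z_norm (minus y x) < e.

Lemma l1Z_ball_center (x : l1Z) (e : posreal) : l1Z_ball x e x.
Proof.
unfold l1Z_ball; replace (minus x x) with (zero : l1Z)
  by (symmetry; exact (minus_eq_zero x)).
rewrite l1Z_norm_zero; apply cond_pos.
Qed.

Lemma l1Z_ball_sym (x y : l1Z) (e : R) : l1Z_ball x e y -> l1Z_ball y e x.
Proof.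
unfold l1Z_ball; intros H; rewrite <- (opp_minus y x), l1Z_norm_opp; exact H.
Qed.

Lemma l1Z_ball_triangle (x y z : l1Z) (e1 e2 : R) :
  l1Z_ball x e1 y -> l1Z_ball y e2 z -> l1Z_ball x (e1 + e2) z.
Proof.
unfold l1Z_ball; intros H1 H2; rewrite (minus_trans y z x).
eapply Rle_lt_trans; [apply l1Z_norm_triangle|lra].
Qed.

Definition l1Z_UniformSpace_mixin : UniformSpace.mixin_of l1Z :=
  UniformSpace.Mixin l1Z l1Z_zero l1Z_ball
    l1Z_ball_center l1Z_ball_sym l1Z_ball_triangle.
Canonical l1Z_UniformSpace : UniformSpace :=
  UniformSpace.Pack l1Z l1Z_UniformSpace_mixin l1Z.

Definition l1Z_NormedModuleAux_class : NormedModuleAux.class_of K l1Z :=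
  NormedModuleAux.Class K l1Z l1Z_ModuleSpace_class l1Z_UniformSpace_mixin.
Canonical l1Z_NormedModuleAux : NormedModuleAux K :=
  NormedModuleAux.Pack K l1Z l1Z_NormedModuleAux_class l1Z.

Lemma l1Z_norm_compat1 (x y : l1Z) (eps : R) :
  l1Z_norm (minus y x) < eps -> ball x eps y.
Proof. intros H; exact H. Qed.

Lemma l1Z_norm_compat2 (x y : l1Z) (eps : posreal) :
  ball x eps y -> l1Z_norm (minus y x) < 1 * eps.
Proof. intros H; rewrite Rmult_1_l; exact H. Qed.

Definition l1Z_NormedModule_mixin :
    NormedModule.mixin_of K l1Z_NormedModuleAux :=
  NormedModule.Mixin K l1Z_NormedModuleAux l1Z_norm 1
    l1Z_norm_triangle l1Z_norm_scal l1Z_norm_compat1 l1Z_norm_compat2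
    l1Z_norm_eq_zero.
Definition l1Z_NormedModule_class : NormedModule.class_of K l1Z :=
  NormedModule.Class K l1Z l1Z_NormedModuleAux_class l1Z_NormedModule_mixin.
Canonical l1Z_NormedModule : NormedModule K :=
  NormedModule.Pack K l1Z l1Z_NormedModule_class l1Z.

Lemma BT_summable (T : X -> X) (HT : is_linear T) (x : l1Z) :
  ex_seriesZ (fun k => norm (T (x (k + 1)%Z))).
Proof.
destruct (linear_norm T HT) as [M [_ HM]].
apply (ex_seriesZ_le _ (fun k => M * norm (x (k + 1)%Z))).
- intros k; split; [apply norm_ge_0|apply HM].
- apply ex_seriesZ_scal, (ex_seriesZ_shift (fun k => norm (x k))), l1Z_summable.
Qed.

(* [is_linear] is Coquelicot's predicate for bounded linear maps. *)
Definition BT (T : X -> X) (HT : is_linear T) (x : l1Z) : l1Z :=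
  mk_l1Z (fun k => T (x (k + 1)%Z)) (BT_summable T HT x).

Lemma is_linear_BT (T : X -> X) (HT : is_linear T) : is_linear (BT T HT).
Proof.
split.
- intros x y; apply l1Z_ext; intros k; apply (linear_plus T HT).
- intros c x; apply l1Z_ext; intros k; apply (linear_scal T HT).
- destruct (linear_norm T HT) as [M [M0 HM]]; exists M; split; [exact M0|].
  intros x; change (l1Z_norm (BT T HT x) <= M * l1Z_norm x); unfold l1Z_norm.
  rewrite <- (SeriesZ_shift (fun k => norm (x k))) by apply l1Z_summable.
  rewrite <- SeriesZ_scal; apply SeriesZ_le.
  + intros k; split; [apply norm_ge_0|apply HM].
  + apply ex_seriesZ_scal, (ex_seriesZ_shift (fun k => norm (x k))).
    apply l1Z_summable.
Qed.

End L1Z.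

Arguments l1Z {K} X.
Arguments l1Z_NormedModule {K} X.

Section L1ZComplete.

Context {K : AbsRing} {X : CompleteNormedModule K}.

Lemma filter_forall_le {U : Type} (F : (U -> Prop) -> Prop) (FF : Filter F)
    (P : nat -> U -> Prop) :
  (forall n, F (P n)) -> forall N, F (fun u => forall n, (n <= N)%nat -> P n u).
Proof.
intros H N; induction N as [|N IH].
- apply (filter_imp (P 0%nat)); [|apply H].
  intros u Hu n Hn; replace n with 0%nat by lia; exact Hu.
- apply (filter_imp (fun u => (forall n, (n <= N)%nat -> P n u) /\ P (S N) u)).
  + intros u [H1 H2] n Hn; destruct (Nat.eq_dec n (S N)) as [->|Hne];
      [exact H2|apply H1; lia].
  + apply filter_and; [exact IH|apply H].
Qed.

Lemma sum_n_le_plus_const (f g : nat -> R) (d : R) (N : nat) :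
  (forall n, (n <= N)%nat -> f n <= g n + d) ->
  sum_n f N <= sum_n g N + INR (S N) * d.
Proof.
induction N as [|N IH]; intros H.
- rewrite !sum_O; simpl; specialize (H 0%nat (le_n 0)); lra.
- rewrite !sum_Sn, S_INR; unfold plus; simpl.
  pose proof (H (S N) (le_n _)).
  assert (sum_n f N <= sum_n g N + INR (S N) * d) by (apply IH; intros; apply H; lia).
  simpl in *; lra.
Qed.

Lemma l1Z_complete_ex (F : (l1Z X -> Prop) -> Prop) :
  ProperFilter F -> cauchy F -> exists y : l1Z X, forall eps : posreal, F (ball y eps).
Proof.
intros FF HF; pose proof (@filter_filter _ _ FF) as FF'.
assert (Hcoord : forall k, exists yk : X, forall eps : posreal,
          F (fun z : l1Z X => norm (minus yk (z k)) < eps)).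
{ intros k.
  set (G := fun P : X -> Prop => F (fun z : l1Z X => P (z k))).
  assert (PG : ProperFilter G).
  { split.
    - intros P HP; destruct (filter_ex (fun z : l1Z X => P (z k)) HP) as [z Hz];
      now exists (z k).
    - split.
      + apply filter_true.
      + intros P Q HP HQ; unfold G in *.
        exact (filter_and (fun z : l1Z X => P (z k)) (fun z => Q (z k)) HP HQ).
      + intros P Q HPQ; unfold G.
        apply (filter_imp (fun z : l1Z X => P (z k))); intros z; apply HPQ. }
  assert (CG : cauchy G).
  { intros eps; destruct (HF eps) as [x Hx]; exists (x k).
    change (F (fun z : l1Z X => ball (x k) eps (z k))).
    apply (filter_imp (ball x eps)); [|exact Hx]; intros z Hz.
    apply (@norm_compat1 K X); eapply Rle_lt_trans; [|exact Hz].
    apply (l1Z_coord_le_norm (minus z x) k). }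
  exists (lim G); intros eps.
  assert (He : 0 < eps / @norm_factor K X).
  { apply Rdiv_lt_0_compat; [apply cond_pos|apply norm_factor_gt_0]. }
  apply (filter_imp (fun z : l1Z X => ball (lim G) (mkposreal _ He) (z k)));
    [|exact (complete_cauchy G PG CG (mkposreal _ He))].
  intros z Hz; apply (@norm_compat2 K X) in Hz; simpl in Hz.
  rewrite <- norm_opp, opp_minus.
  replace (pos eps) with (@norm_factor K X * (eps / @norm_factor K X)); [exact Hz|].
  field; apply Rgt_not_eq, norm_factor_gt_0. }
set (y := fun k => proj1_sig (constructive_indefinite_description _ (Hcoord k))).
assert (Hy : forall k (eps : posreal), F (fun z : l1Z X => norm (minus (y k) (z k)) < eps)).
{ intros k; exact (proj2_sig (constructive_indefinite_description _ (Hcoord k))). }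
assert (Hb : forall (eps : posreal) (x : l1Z X), F (ball x eps) ->
   ex_seriesZ (fun k => norm (minus (y k) (x k))) /\
   SeriesZ (fun k => norm (minus (y k) (x k))) <= eps).
{ intros eps x Hx; apply SeriesZ_bound; [intros k; apply norm_ge_0|].
  intros N; apply Rnot_lt_le; intros Hlt.
  set (S0 := partialZ (fun k => norm (minus (y k) (x k))) N) in *.
  assert (HN : 0 < INR (S N)) by (apply lt_0_INR; lia).
  assert (Hd : 0 < (S0 - eps) / (2 * INR (S N))).
  { apply Rdiv_lt_0_compat; lra. }
  set (d := mkposreal _ Hd).
  pose proof (filter_forall_le F FF' _ (fun n => Hy (Z.of_nat n) d) N) as A.
  pose proof (filter_forall_le F FF' _ (fun n => Hy (- Z.of_nat (S n))%Z d) N) as B.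
  destruct (filter_ex _ (filter_and _ _ Hx (filter_and _ _ A B)))
    as [z [Hz [Az Bz]]].
  assert (T : forall k, norm (minus (y k) (z k)) < d ->
     norm (minus (y k) (x k)) <= norm (minus (z k) (x k)) + d).
  { intros k Hk.
  refine (Rle_trans _ _ _ (norm_minus_triangle (y k) (z k) (x k)) _).
  rewrite Rplus_comm; apply Rplus_le_compat_l, Rlt_le; exact Hk. }
  pose proof (sum_n_le_plus_const _ _ d N (fun n Hn => T _ (Az n Hn))) as A'.
  pose proof (sum_n_le_plus_const _ _ d N (fun n Hn => T _ (Bz n Hn))) as B'.
  assert (P : partialZ (fun k => norm (minus (z k) (x k))) N < eps).
  { eapply Rle_lt_trans; [|exact Hz].
    apply (partialZ_le_SeriesZ (fun k => norm (minus (z k) (x k))));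
      [intros k; apply norm_ge_0|].
    exact (l1Z_summable (minus z x)). }
  assert (E : 2 * (INR (S N) * d) = S0 - eps).
  { unfold d; cbn [pos]; field; lra. }
  unfold partialZ in P; unfold S0, partialZ in E; lra. }
destruct (HF (mkposreal 1 Rlt_0_1)) as [x1 Hx1].
assert (Ysum : ex_seriesZ (fun k => norm (y k))).
{ apply (ex_seriesZ_le _ (fun k => norm (minus (y k) (x1 k)) + norm (x1 k))).
  - intros k; split; [apply norm_ge_0|].
    exact (norm_le_minus (y k) (x1 k)).
  - apply ex_seriesZ_plus; [exact (proj1 (Hb _ _ Hx1))|apply l1Z_summable]. }
exists (mk_l1Z y Ysum); intros eps.
destruct (HF (pos_div_2 (pos_div_2 eps))) as [x Hx].
assert (Hyx : ball (mk_l1Z y Ysum) (eps / 2) x).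
{ apply ball_sym.
  change (l1Z_norm (minus (mk_l1Z y Ysum) x) < eps / 2).
  eapply Rle_lt_trans; [exact (proj2 (Hb _ _ Hx))|].
  simpl; pose proof (cond_pos eps); lra. }
apply (filter_imp (ball x (eps / 2 / 2))); [|exact Hx].
intros z Hz; apply ball_le with (eps / 2 + eps / 2 / 2).
- pose proof (cond_pos eps); lra.
- exact (ball_triangle _ _ _ _ _ Hyx Hz).
Qed.

(* Coquelicot asks for a limit operator defined on all filters, including those
   that do not converge. *)
Definition l1Z_lim (F : (l1Z X -> Prop) -> Prop) : l1Z X :=
  epsilon (inhabits l1Z_zero) (fun y : l1Z X => forall eps : posreal, F (ball y eps)).

Lemma l1Z_complete_cauchy (F : (l1Z X -> Prop) -> Prop) :
  ProperFilter F -> cauchy F -> forall eps : posreal, F (ball (l1Z_lim F) eps).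
Proof. intros FF HF; exact (epsilon_spec _ _ (l1Z_complete_ex F FF HF)). Qed.

Lemma l1Z_close_lim (F1 F2 : (l1Z X -> Prop) -> Prop) :
  filter_le F1 F2 -> filter_le F2 F1 -> close (l1Z_lim F1) (l1Z_lim F2).
Proof.
intros H1 H2; replace F2 with F1; [intros eps; apply ball_center|].
apply functional_extensionality; intros P.
apply propositional_extensionality; split; [apply H2|apply H1].
Qed.

Definition l1Z_CompleteSpace_mixin : CompleteSpace.mixin_of (l1Z_NormedModule X) :=
  CompleteSpace.Mixin (l1Z_NormedModule X) l1Z_lim
    l1Z_complete_cauchy l1Z_close_lim.
Canonical l1Z_CompleteNormedModule : CompleteNormedModule K :=
  CompleteNormedModule.Pack K (l1Z X)
    (CompleteNormedModule.Class K (l1Z X) l1Z_NormedModule_class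
       l1Z_CompleteSpace_mixin) (l1Z X).

End L1ZComplete.

Arguments l1Z_CompleteNormedModule {K} X.

Definition dense_range {Y X : UniformSpace} (phi : Y -> X) : Prop :=
  forall (x : X) (eps : posreal), exists y : Y, ball x eps (phi y).

Definition quasi_conjugate {X Y : UniformSpace} (T : X -> X) (S : Y -> Y) : Prop :=
  exists phi : Y -> X,
    (forall y, continuous phi y) /\ dense_range phi /\
    (forall y, phi (S y) = T (phi y)).

(* Main.v *)
(** The summation map [phi y = sum_k y_k] from l^1(X,Z) to X is linear, bounded
    by 1 and surjective, and since the sum over Z is invariant under the shift,
    [phi (BT y) = sum_k T y_(k+1) = T (sum_k y_k) = T (phi y)]. *)
Require Import Defs.
From Stdlib Require Import Reals ZArith.
From Coquelicot Require Import Coquelicot.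
From Stdlib Require Import Lia ClassicalEpsilon.

Lemma plus_opp_cancel_r {G : AbelianGroup} (x y : G) :
  plus (plus x (opp y)) y = x.
Proof.
rewrite <- plus_assoc; transitivity (plus x zero); [|apply plus_zero_r].
f_equal; apply plus_opp_l.
Qed.

Lemma plus_cancel_opp_r {G : AbelianGroup} (x y : G) :
  plus (plus x y) (opp y) = x.
Proof. now rewrite <- plus_assoc, plus_opp_r, plus_zero_r. Qed.

Section NormedSeries.

Context {K : AbsRing} {V : NormedModule K}.

Lemma is_series_eq (a : nat -> V) (l l' : V) :
  is_series a l -> is_series a l' -> l = l'.
Proof. apply filterlim_locally_unique. Qed.

Lemma is_series_zero : is_series (fun _ : nat => zero : V) zero.
Proof.
apply (filterlim_ext (fun _ : nat => zero : V)); [|apply filterlim_const].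
intros n; induction n as [|n IH].
- now rewrite sum_O.
- now rewrite sum_Sn, <- IH, plus_zero_r.
Qed.

(** The triangle inequality for partial sums passes to the limit, since the norm is continuous. *)
Lemma norm_series_le (a : nat -> V) (l : V) :
  is_series a l -> ex_series (fun n => norm (a n)) ->
  norm l <= Series (fun n => norm (a n)).
Proof.
intros Ha Hn.
apply (is_lim_seq_le (fun n => norm (sum_n a n)) (sum_n (fun n => norm (a n)))
         (norm l) (Series (fun n => norm (a n)))).
- intros n; apply norm_sum_n_m.
- exact (filterlim_comp _ _ _ _ _ _ _ _ Ha (filterlim_norm l)).
- exact (Series_correct _ Hn).
Qed.

(** [f] commutes with finite sums by additivity and with the limit by continuity. *)
Lemma is_series_linear {W : NormedModule K} (f : V -> W) (a : nat -> V) (l : V) :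
  is_linear f -> is_series a l -> is_series (fun n => f (a n)) (f l).
Proof.
intros Hf Ha.
apply (filterlim_ext (fun n => f (sum_n a n))).
- intros n; induction n as [|n IH].
  + now rewrite !sum_O.
  + now rewrite !sum_Sn, (linear_plus f Hf), IH.
- exact (filterlim_comp _ _ _ _ _ _ _ _ Ha (linear_cont f l Hf)).
Qed.

(** The two halves split as in [ex_seriesZ], with index 0 in the first one only. A relation serves
    here because sums need not exist in a general [V]. *)
Definition is_seriesZ (f : Z -> V) (s : V) : Prop :=
  exists a b : V,
    is_series (fun n : nat => f (Z.of_nat n)) a /\
    is_series (fun n : nat => f (- Z.of_nat (S n))%Z) b /\ s = plus a b.

Lemma is_seriesZ_eq (f : Z -> V) (s s' : V) :
  is_seriesZ f s -> is_seriesZ f s' -> s = s'.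
Proof.
intros (a & b & Ha & Hb & ->) (a' & b' & Ha' & Hb' & ->).
now rewrite (is_series_eq _ _ _ Ha Ha'), (is_series_eq _ _ _ Hb Hb').
Qed.

Lemma is_seriesZ_plus (f g : Z -> V) (s t : V) :
  is_seriesZ f s -> is_seriesZ g t ->
  is_seriesZ (fun k => plus (f k) (g k)) (plus s t).
Proof.
intros (a & b & Ha & Hb & ->) (a' & b' & Ha' & Hb' & ->).
exists (plus a a'), (plus b b'); repeat split.
- exact (is_series_plus _ _ _ _ Ha Ha').
- exact (is_series_plus _ _ _ _ Hb Hb').
- rewrite <- !plus_assoc; f_equal; rewrite !plus_assoc; f_equal.
  apply plus_comm.
Qed.

Lemma is_seriesZ_scal (c : K) (f : Z -> V) (s : V) :
  is_seriesZ f s -> is_seriesZ (fun k => scal c (f k)) (scal c s).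
Proof.
intros (a & b & Ha & Hb & ->); exists (scal c a), (scal c b); repeat split.
- exact (is_series_scal c _ _ Ha).
- exact (is_series_scal c _ _ Hb).
- apply @scal_distr_l.
Qed.

(** The shift moves the single term [f 0] from the nonnegative half to the negative half, so the
    half sums become [a - f 0] and [b + f 0], with the same total. *)
Lemma is_seriesZ_shift (f : Z -> V) (s : V) :
  is_seriesZ f s -> is_seriesZ (fun k => f (k + 1)%Z) s.
Proof.
intros (a & b & Ha & Hb & ->).
exists (plus a (opp (f 0%Z))), (plus b (f 0%Z)); repeat split.
- apply (is_series_ext (fun n => f (Z.of_nat (S n)))).
  + intros n; f_equal; lia.
  + apply (is_series_incr_1 (fun n => f (Z.of_nat n))).
    (* Transport by [eq_ind_r] works up to conversion: the dropped term reads [f (Z.of_nat 0)], not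
       literally [f 0]. *)
    exact (eq_ind_r (is_series _) Ha (plus_opp_cancel_r a (f 0%Z))).
(* The shifted negative half starts with [f (-1 + 1) = f 0]; without that term it is the original
   negative half. *)
- apply is_series_decr_1.
  apply (is_series_ext (fun n => f (- Z.of_nat (S n))%Z)).
  + intros n; f_equal; lia.
  + exact (eq_ind_r (is_series _) Hb (plus_cancel_opp_r b (f 0%Z))).
- rewrite (plus_comm b), plus_assoc; f_equal; symmetry.
  exact (plus_opp_cancel_r a (f 0%Z)).
Qed.

Lemma is_seriesZ_single (x : V) :
  is_seriesZ (fun k => if Z.eqb k 0 then x else zero) x.
Proof.
exists x, zero; repeat split.
- apply is_series_decr_1.
  exact (eq_ind_r (is_series _) is_series_zero (plus_opp_r x)).
- exact is_series_zero.
- now rewrite plus_zero_r.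
Qed.

Lemma norm_seriesZ_le (f : Z -> V) (s : V) :
  ex_seriesZ (fun k => norm (f k)) -> is_seriesZ f s ->
  norm s <= SeriesZ (fun k => norm (f k)).
Proof.
intros [H1 H2] (a & b & Ha & Hb & ->).
refine (Rle_trans _ _ _ (norm_triangle a b) _).
apply Rplus_le_compat; now apply norm_series_le.
Qed.

End NormedSeries.

Lemma is_seriesZ_linear {K : AbsRing} {V W : NormedModule K} (f : V -> W)
    (x : Z -> V) (s : V) :
  is_linear f -> is_seriesZ x s -> is_seriesZ (fun k => f (x k)) (f s).
Proof.
intros Hf (a & b & Ha & Hb & ->); exists (f a), (f b); repeat split.
- exact (is_series_linear f _ _ Hf Ha).
- exact (is_series_linear f _ _ Hf Hb).
- apply (linear_plus f Hf).
Qed.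

(** Once the first term of the nonnegative half is dropped, both halves are those of the zero
    family. *)
Lemma ex_seriesZ_single (c : R) :
  ex_seriesZ (fun k => if Z.eqb k 0 then c else 0).
Proof.
destruct ex_seriesZ_zero as [H1 H2]; split; [|exact H2].
apply ex_series_incr_1; exact H1.
Qed.

Section SumMap.

Context {K : AbsRing} {X : CompleteNormedModule K}.

(** Completeness of [X] enters here: each half converges absolutely, hence converges. *)
Lemma l1Z_has_sum (y : l1Z X) : exists s : X, is_seriesZ y s.
Proof.
destruct (l1Z_summable y) as [H1 H2].
destruct (ex_series_le _ _ (fun n => Rle_refl _) H1) as [a Ha].
destruct (ex_series_le _ _ (fun n => Rle_refl _) H2) as [b Hb].
exists (plus a b), a, b; repeat split; assumption.
Qed.

(** Existence of the sum is only a proposition, so a value is chosen; [is_seriesZ_eq] makes the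
    choice immaterial. *)
Definition l1Z_sum (y : l1Z X) : X :=
  proj1_sig (constructive_indefinite_description _ (l1Z_has_sum y)).

Lemma l1Z_sum_correct (y : l1Z X) : is_seriesZ y (l1Z_sum y).
Proof. exact (proj2_sig (constructive_indefinite_description _ (l1Z_has_sum y))). Qed.

Lemma l1Z_sum_eq (y : l1Z X) (s : X) : is_seriesZ y s -> l1Z_sum y = s.
Proof. apply is_seriesZ_eq, l1Z_sum_correct. Qed.

Lemma is_linear_l1Z_sum : is_linear l1Z_sum.
Proof.
split.
- intros x y; apply l1Z_sum_eq.
  exact (is_seriesZ_plus _ _ _ _ (l1Z_sum_correct x) (l1Z_sum_correct y)).
- intros c x; apply l1Z_sum_eq.
  exact (is_seriesZ_scal c _ _ (l1Z_sum_correct x)).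
(* The bound 1 is the triangle inequality over Z, as the norm of [x] is by definition the sum of the
   norms of its entries. *)
- exists 1; split; [exact Rlt_0_1|intros x; rewrite Rmult_1_l].
  exact (norm_seriesZ_le _ _ (l1Z_summable x) (l1Z_sum_correct x)).
Qed.

(** The family with [x] at index 0 and [zero] elsewhere is a preimage. *)
Lemma l1Z_sum_surjective (x : X) : exists y : l1Z X, l1Z_sum y = x.
Proof.
assert (H : ex_seriesZ (fun k => norm (if Z.eqb k 0 then x else zero))).
{ apply (ex_seriesZ_ext (fun k => if Z.eqb k 0 then norm x else 0)).
  - intros k; destruct (Z.eqb k 0); [reflexivity|now rewrite norm_zero].
  - apply ex_seriesZ_single. }
exists (mk_l1Z _ H); apply l1Z_sum_eq, is_seriesZ_single.
Qed.

Lemma l1Z_sum_BT (T : X -> X) (HT : is_linear T) (y : l1Z X) :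
  l1Z_sum (BT T HT y) = T (l1Z_sum y).
Proof.
apply l1Z_sum_eq, (is_seriesZ_shift (fun k => T (y k))).
exact (is_seriesZ_linear T _ _ HT (l1Z_sum_correct y)).
Qed.

End SumMap.

Theorem proposition3p9 (K : AbsRing) (hK : K = R_AbsRing \/ K = C_AbsRing)
  (X : CompleteNormedModule K) (T : X -> X) (HT : is_linear T) :
  quasi_conjugate T (BT T HT).
Proof.
exists l1Z_sum; repeat split.
- intros y; exact (linear_cont l1Z_sum y is_linear_l1Z_sum).
(* An exact preimage of [x] serves for every [eps]. *)
- intros x eps; destruct (l1Z_sum_surjective x) as [y Hy].
  exists y; rewrite Hy; apply ball_center.
- apply l1Z_sum_BT.
Qed.
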